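(* Let $\mathcal{C}$ be a bounded below graded poset and let $F:\mathcal{C}\rightarrow \mathrm{Ab}$ be a functor. Then $F$ is a projective object of the functor category $\mathrm{Ab}^{\mathcal{C}}$ if and only if both of the following conditions hold: (1) for every object $i_0$ of $\mathcal{C}$, the group $\mathrm{Coker}_F(i_0)$ is a free abelian group; (2) $F$ is pseudo-projective.
   Context: $\mathrm{Ab}$ is the category of abelian groups and $\mathrm{Ab}^{\mathcal{C}}$ is the abelian category of (covariant) functors $\mathcal{C}\to\mathrm{Ab}$ and natural transformations, for $\mathcal{C}$ small. A poset $\mathcal{P}$ is regarded as a category with exactly one arrow $p\to p'$ if $p\le p'$ and none otherwise. Graded poset: for $p<p'$ in $\mathcal{P}$, $p$ precedes $p'$ if $p\le p''\le p'$ implies $p''=p$ or $p''=p'$. $\mathcal{P}$ is graded if there is a function $\deg:\mathrm{Ob}(\mathcal{P})\to\mathbb{Z}$ (an increasing degree function) which is strictly order preserving ($p<p'$ implies $\deg(p)<\deg(p')$) and such that $\deg(p')=\deg(p)+1$ whenever $p$ precedes $p'$. For an arrow $p\to p'$ set $\deg(p\to p')=|\deg(p')-\deg(p)|$; this does not depend on the choice of degree function. $\mathcal{P}$ is bounded below if $\deg(\mathrm{Ob}(\mathcal{P}))\subset\mathbb{Z}$ has a lower bound, for an increasing degree function $\deg$. For a functor $F:\mathcal{P}\to\mathrm{Ab}$ and an object $i_0$, let $\mathrm{Im}_F(i_0)=\sum_{\alpha:i\to i_0,\ \alpha\ne 1_{i_0}}\mathrm{Im}\,F(\alpha)\subseteq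 F(i_0)$ (equal to $0$ if there is no such $\alpha$), and $\mathrm{Coker}_F(i_0)=F(i_0)/\mathrm{Im}_F(i_0)$. For $d\ge 0$, $F$ is $d$-pseudo-projective if for any object $i_0$, any $k$ different objects $i_1,\dots,i_k$, arrows $\alpha_j:i_j\to i_0$ with $\deg(\alpha_j)=d$ and elements $x_j\in F(i_j)$ ($j=1,\dots,k$) such that $\sum_{j=1}^k F(\alpha_j)(x_j)=0$, one has $x_j\in\mathrm{Im}_F(i_j)$ for all $j=1,\dots,k$. (For $d=0$ this always holds.) $F$ is pseudo-projective if it is $d$-pseudo-projective for every $d\ge0$. *)

(* Defs.v *)
From HB Require Import structures.
From mathcomp Require Import all_boot all_order all_algebra.
From mathcomp Require Import boolp.
From mathcomp.multinomials Require Import freeg.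

Set Implicit Arguments.
Unset Strict Implicit.
Unset Printing Implicit Defensive.

Import Order.TTheory GRing.Theory.

Local Open Scope ring_scope.

(* Covariant functors from a poset to abelian groups. The order of a
   porderType is boolean-valued, so a proof of p <= q is unique and serves as
   the unique arrow p -> q. Classically, every poset is a porderType and every
   abelian group is a zmodType. *)
Record functorAb (d : Order.disp_t) (P : porderType d) := FunctorAb {
  fobj :> P -> zmodType;
  fmap : forall p q : P, (p <= q)%O -> {additive fobj p -> fobj q};
  fmap_id : forall (p : P) (x : fobj p), fmap (lexx p) x = x;
  fmap_comp : forall (p q r : P) (pq : (p <= q)%O) (qr : (q <= r)%O)
    (x : fobj p), fmap (le_trans pq qr) x = fmap qr (fmap pq x)
}.

Record nattrans (d : Order.disp_t) (P : porderType d) (F G : functorAb P) :=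
  Nattrans {
    component :> forall p : P, {additive F p -> G p};
    naturality : forall (p q : P) (pq : (p <= q)%O) (x : F p),
      component q (fmap F pq x) = fmap G pq (component p x)
  }.

Section Functors.
Variables (d : Order.disp_t) (P : porderType d).
Implicit Types F G H K : functorAb P.

Lemma nt_comp_subproof F G H (b : nattrans G H) (a : nattrans F G)
    (p q : P) (pq : (p <= q)%O) (x : F p) :
  (b q \o a q) (fmap F pq x) = fmap H pq ((b p \o a p) x).
Proof. by rewrite /= !naturality. Qed.

Definition nt_comp F G H (b : nattrans G H) (a : nattrans F G) :
    nattrans F H :=
  @Nattrans d P F H (fun p => b p \o a p) (nt_comp_subproof b a).

(* Equality of arrows of the functor category, stated pointwise. *)
Definition nt_eq F G (a b : nattrans F G) : Prop := forall p : P, a p =1 b p.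

Definition epimorphism G H (e : nattrans G H) : Prop :=
  forall (K : functorAb P) (a b : nattrans H K),
    nt_eq (nt_comp a e) (nt_comp b e) -> nt_eq a b.

Definition projective F : Prop :=
  forall (G H : functorAb P) (e : nattrans G H) (f : nattrans F H),
    epimorphism e -> exists g : nattrans F G, nt_eq (nt_comp e g) f.

(* In a poset, an arrow i -> i0 differs from the identity iff i < i0. The
   sum of the subgroups Im F(i -> i0) is the set of finite sums of their
   elements, with repeated indices allowed. *)
Definition Im F (i0 : P) (y : F i0) : Prop :=
  exists s : seq {i : {i : P | (i < i0)%O} & F (val i)},
    y = \sum_(t <- s) fmap F (ltW (valP (tag t))) (tagged t).

Definition Im_pred F (i0 : P) : {pred F i0} := fun y => `[< Im y >].

Lemma Im_zmod_closed F (i0 : P) : zmod_closed (@Im_pred F i0).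
Proof.
split=> [|x y /asboolP[s ->] /asboolP[t ->]]; apply/asboolP.
  by exists [::]; rewrite big_nil.
pose T (i : {i : P | (i < i0)%O}) : Type := F (val i).
exists (s ++ [seq existT T (tag u) (- (tagged u : F (val (tag u)))) | u <- t]).
rewrite big_cat big_map -sumrN; congr (_ + _).
by apply: eq_bigr => u _; rewrite raddfN.
Qed.

HB.instance Definition _ F (i0 : P) :=
  GRing.isZmodClosed.Build (F i0) (@Im_pred F i0) (@Im_zmod_closed F i0).

Definition Coker F (i0 : P) : zmodType := {ideal_quot (@Im_pred F i0)}.

Definition precedes (p q : P) : Prop :=
  (p < q)%O /\ forall r : P, (p <= r)%O -> (r <= q)%O -> r = p \/ r = q.

Definition degree_function (deg : P -> int) : Prop :=
  (forall p q : P, (p < q)%O -> deg p < deg q) /\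
  (forall p q : P, precedes p q -> deg q = deg p + 1).

Definition arrow_degree (deg : P -> int) (p q : P) (pq : (p <= q)%O) : nat :=
  `|deg q - deg p|%N.

Definition d_pseudo_projective (deg : P -> int) (n : nat) F : Prop :=
  forall (i0 : P) (k : nat) (i : 'I_k -> P), injective i ->
  forall alpha : (forall j : 'I_k, (i j <= i0)%O),
  (forall j : 'I_k, arrow_degree deg (alpha j) = n) ->
  forall x : (forall j : 'I_k, F (i j)),
  \sum_(j < k) fmap F (alpha j) (x j) = 0 ->
  forall j : 'I_k, Im (x j).

(* deg is any degree function of P: the degree of an arrow is the same for all
   of them. *)
Definition pseudo_projective (deg : P -> int) F : Prop :=
  forall n : nat, d_pseudo_projective deg n F.

End Functors.

(* A disconnected poset can have both bounded below and unbounded degree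
   functions, so the lower bound is required of some degree function. *)
Definition bounded_below_graded (d : Order.disp_t) (P : porderType d) : Prop :=
  exists2 deg : P -> int, degree_function deg &
    exists m : int, forall p : P, m <= deg p.

Definition free_abelian (A : zmodType) : Prop :=
  exists (B : choiceType) (f : {additive {freeg B / int} -> A}), bijective f.

(* Main.v *)
(* For a family of sets T i, the free functor Q on T has Q p free on the pairs
   (i, t) with i <= p and t in T i, and Im_Q(p) is spanned by the pairs with
   i <> p.

   If F is projective, it is a retract of the free functor Q on its own
   elements. Hence Coker_F(p) embeds in the free group on F p, and is free since
   subgroups of free abelian groups are. In a relation sum_j Q(alpha_j)(u_j) = 0
   between distinct i_j of one degree, the pairs with first component i_j occur
   in u_j only, so their coefficients vanish, u_j lies in Im_Q, and applying the
   retraction gives pseudo-projectivity.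

   Conversely, lift bases B p of the groups Coker_F(p) to F, and let
   Phi : Q -> F be the induced map from the free functor on B. It is onto by
   induction from the bottom degree. If Phi u = 0 with u <> 0, let D be the
   largest degree of an i occurring in u. Every arrow i -> p in u factors
   through an object of degree D, so u = sum_j Q(i_j -> p)(v_j) with distinct
   i_j of degree D. Pseudo-projectivity puts Phi v_j in Im_F(i_j), so the
   coefficients of v_j at the pairs over i_j vanish, against the choice of D.
   Thus F is isomorphic to a free functor. *)
From HB Require Import structures.
From mathcomp Require Import all_boot all_order all_algebra.
From mathcomp Require Import boolp wochoice.
From mathcomp.multinomials Require Import freeg.
Import Order.TTheory GRing.Theory Num.Theory.
Require Import Defs.

Set Implicit Arguments.
Unset Strict Implicit.
Unset Printing Implicit Defensive.

Local Open Scope ring_scope.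

(** * Homomorphisms out of free abelian groups *)

Section IntLift.
Variables (T : choiceType) (A : zmodType).

(** [fglift] takes values in a module; [zmodule A] is [A] with its canonical structure of module
    over the integers. *)
Definition zlift (f : T -> A) (u : {freeg T / int}) : A :=
  fglift (f : T -> zmodule A) u.

Lemma zlift_is_zmod_morphism f : zmod_morphism (zlift f).
Proof. exact: (@lift_is_additive _ _ (zmodule A)). Qed.

HB.instance Definition _ f :=
  GRing.isZmodMorphism.Build {freeg T / int} A (zlift f)
    (zlift_is_zmod_morphism f).

Lemma zliftU f t : zlift f << t >> = f t.
Proof. by rewrite /zlift liftU scalezrE mulr1z. Qed.

Lemma freeg_sumzE (u : {freeg T / int}) :
  u = \sum_(t <- dom u) << t >> *~ coeff t u.
Proof.
rewrite -[LHS]freeg_sumE; apply: eq_bigr => t _.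
by rewrite freeg_mulz intz.
Qed.

Lemma raddf_freeg (h : {additive {freeg T / int} -> A}) u :
  h u = \sum_(t <- dom u) h << t >> *~ coeff t u.
Proof.
by rewrite {1}[u]freeg_sumzE raddf_sum; apply: eq_bigr => t _; rewrite raddfMz.
Qed.

Lemma freeg_ext (g h : {additive {freeg T / int} -> A}) :
  (forall t, g << t >> = h << t >>) -> g =1 h.
Proof.
by move=> gh u; rewrite !raddf_freeg; apply: eq_bigr => t _; rewrite gh.
Qed.

Lemma freeg_in_closed (S : zmodClosed A) (h : {additive {freeg T / int} -> A}) :
  (forall t, h << t >> \in S) -> forall u, h u \in S.
Proof.
move=> hS u; rewrite raddf_freeg rpred_sum // => t _.
by rewrite rpredMz.
Qed.

End IntLift.

(** * Subgroups of free abelian groups *)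

Lemma seq_max (T : eqType) (R : rel T) (s : seq T) :
  reflexive R -> transitive R -> total R -> s != [::] ->
  exists2 m, m \in s & {in s, forall x, R x m}.
Proof.
move=> Rr Rt Rtot; elim: s => // x s IHs _.
have [->|/IHs[m ms Rm]] := eqVneq s [::].
  by exists x => [|y]; rewrite inE // => /eqP->.
have [xm|mx] := orP (Rtot x m).
  by exists m => [|y]; rewrite inE ?ms ?orbT // => /predU1P[->|/Rm].
exists x => [|y]; rewrite inE ?eqxx // => /predU1P[->|/Rm /Rt]; last exact.
exact: Rr.
Qed.

(* Fix a well-order R of T. For each t that is the R-largest key of some a in
   A, choose such an a whose coefficient at t generates the ideal of all leading
   coefficients at t. The chosen elements form a basis of A. *)
Section SubgroupOfFree.
Variables (A : zmodType) (T : choiceType) (j : {additive A -> {freeg T / int}}).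
Hypothesis j_inj : injective j.
Variable R : rel T.
Hypothesis R_wo : well_order R.

Let R_chain : wo_chain R T.
Proof. exact: withinW. Qed.

Let R_total : total R.
Proof. by move=> x y; apply: (wo_chainW R_chain). Qed.

Let R_refl : reflexive R.
Proof. by move=> x; apply: (wo_chain_reflexive R_chain). Qed.

Let R_anti : antisymmetric R.
Proof. by move=> x y; apply: (wo_chain_antisymmetric R_chain). Qed.

Let R_trans : transitive R.
Proof.
move=> y x z xy yz.
(* If the least of the three is [x], the claim is immediate; if it is [y] or [z], antisymmetry
   identifies two neighbours. *)
have [|t [[tin tmin] _]] := R_wo (A := [pred t | t \in [:: x; y; z]]).
  by exists x; rewrite !inE eqxx.
have [tx ty tz] : [/\ R t x, R t y & R t z].
  by split; apply: tmin; rewrite !inE eqxx ?orbT.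
move: tin; rewrite !inE => /or3P[]/eqP et; rewrite {t}et // in tx ty tz tmin *.
  by rewrite (R_anti (introT andP (conj xy tx))).
by rewrite -(R_anti (introT andP (conj yz ty))).
Qed.

Let supp_le (t : T) (a : A) : Prop := {in dom (j a), forall s, R s t}.
Let c (t : T) (a : A) : int := coeff t (j a).

Let cE t : {morph c t : a b / a - b}.
Proof. by move=> a b; rewrite /c !raddfB. Qed.

Let cMz t a z : c t (a *~ z) = c t a * z.
Proof. by rewrite /c !raddfMz mulrzz. Qed.

Let supp_leB t a b z : supp_le t a -> supp_le t b -> supp_le t (a - b *~ z).
Proof.
move=> ta tb s; rewrite mem_dom -/(c s _) cE cMz => nz.
have [/ta//|a0] := boolP (s \in dom (j a)).
have [/tb//|b0] := boolP (s \in dom (j b)).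
by move: nz; rewrite /c !coeff_outdom // mul0r subrr eqxx.
Qed.

Let leading (t : T) (a : A) : Prop :=
  [/\ supp_le t a, c t a != 0 &
     forall b, supp_le t b -> exists z : int, c t b = c t a * z].

Let leading_exists t a : supp_le t a -> c t a != 0 -> exists b, leading t b.
Proof.
move=> ta nz.
have exn : exists n,
    `[< exists2 b, supp_le t b & (c t b != 0) && (`|c t b|%N == n) >].
  by exists `|c t a|%N; apply/asboolP; exists a; rewrite ?nz ?eqxx.
case: (ex_minnP exn) => n /asboolP[b tb /andP[nzb /eqP nb]] nmin.
(* A nonzero remainder would be the coefficient at [t] of [b' - b *~ q], smaller in absolute value
   than the minimal [n]. *)
exists b; split=> // b' tb'; exists (c t b' %/ c t b)%Z.
apply/eqP; rewrite mulrC -subr_eq0; apply/negPn/negP => nzr.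
set r := (_ - _) in nzr; have rE : r = c t (b' - b *~ (c t b' %/ c t b)%Z).
  by rewrite cE cMz mulrC.
have rM : r = (c t b' %% c t b)%Z by [].
have : (n <= `|r|)%N.
  apply: nmin; apply/asboolP; exists (b' - b *~ (c t b' %/ c t b)%Z).
    exact: supp_leB.
  by rewrite -rE nzr eqxx.
rewrite leqNgt -nb => /negP[]; rewrite -ltz_nat !abszE rM.
by rewrite ger0_norm ?modz_ge0 // ltz_mod.
Qed.

Lemma sub_free_of_well_order : free_abelian A.
Proof.
pose B : choiceType := {t : T | `[< exists a, leading t a >]}.
pose lead (t : B) : {a | leading (val t) a} := cid (asboolW (valP t)).
pose b (t : B) : A := sval (lead t).
have bP t : leading (val t) (b t) by exact: svalP (lead t).
exists B, (zlift b).
(* Independence: at the largest key [m] of [u] only [b m] contributes, since [m] in the support of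
   another [b k] would force [m] below [k]. *)
have zinj u : zlift b u = 0 -> u = 0.
  move=> u0; apply/eqP; rewrite -dom_eq0; apply/negPn/negP => nz.
  have nz' : [seq val t | t <- dom u] != [::] by case: (dom u) nz.
  have [_ /mapP[m mu ->] mmax] := seq_max R_refl R_trans R_total nz'.
  have /eqP : c (val m) (zlift b u) = 0 by rewrite u0 /c !raddf0.
  rewrite /c [zlift b u]raddf_freeg !raddf_sum.
  rewrite (bigD1_seq m) ?uniq_dom //= big1_seq ?addr0 => [|k /andP[km ku]].
    rewrite !raddfMz zliftU mulrzz mulf_eq0 -/(c _ _).
    by case: (bP m) => _ /negPf-> _; rewrite -[_ == 0]negbK -mem_dom mu.
  rewrite !raddfMz zliftU [X in X *~ _]coeff_outdom ?mul0rz //.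
  apply/negP => mk.
  case/negP: km; apply/eqP/val_inj/R_anti; apply/andP; split.
    exact/mmax/map_f.
  by case: (bP k) => /(_ _ mk).
have zsur a : exists u, zlift b u = a.
  suff gen t a' : supp_le t a' -> exists u, zlift b u = a'.
    have [j0|nz] := eqVneq (dom (j a)) [::].
      exists 0; rewrite raddf0; apply: j_inj; rewrite raddf0.
      by apply/esym/eqP; rewrite -dom_eq0 j0.
    by have [m _ mmax] := seq_max R_refl R_trans R_total nz; apply: (gen m).
  move: t a'; apply: contrapT => bad.
  (* Generation: [t0] will be the least key that bounds the support of an element outside the span
     of the [b t]. *)
  pose bads : {pred T} :=
    fun t => `[< exists2 a', supp_le t a' & ~ exists u, zlift b u = a' >].
  have [|t0 [[/asboolP[a0 ta0 na0] t0min] _]] := R_wo (A := bads).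
    apply/not_existsP => nobad; apply: bad => t' a'' ta''.
    by apply: contra_notP (nobad t') => na; apply/asboolP; exists a''.
  (* With coefficient 0 at [t0], the largest key lies strictly below [t0], where minimality
     applies. *)
  have gen0 a' : supp_le t0 a' -> c t0 a' = 0 -> exists u, zlift b u = a'.
    move=> ta' c0; have [j0|nz] := eqVneq (dom (j a')) [::].
      exists 0; rewrite raddf0; apply: j_inj; rewrite raddf0.
      by apply/esym/eqP; rewrite -dom_eq0 j0.
    have [m mj mmax] := seq_max R_refl R_trans R_total nz.
    apply: contrapT => na'.
    have mt : m = t0.
      apply: R_anti; rewrite ta' //=; apply: t0min.
      by apply/asboolP; exists a'.
    by move: mj; rewrite mem_dom mt -/(c _ _) c0 eqxx.
  have [c0|nz] := eqVneq (c t0 a0) 0; first exact/na0/gen0.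
  have t0B : `[< exists a, leading t0 a >].
    exact/asboolP/(leading_exists ta0 nz).
  pose k : B := Sub t0 t0B.
  have [tk nzk /(_ _ ta0)[z ez]] := bP k.
  case: (gen0 (a0 - b k *~ z)) => [||u ub].
  - exact: supp_leB.
  - by rewrite cE cMz ez subrr.
  apply: na0; exists (u + << k >> *~ z).
  by rewrite raddfD raddfMz /= zliftU ub subrK.
pose g a := sval (cid (zsur a)).
have gK : cancel g (zlift b) by move=> a; exact: svalP (cid (zsur a)).
exists g => // u; apply/subr0_eq/zinj; rewrite raddfB /=.
by rewrite gK subrr.
Qed.

End SubgroupOfFree.

Lemma sub_free_abelian (A : zmodType) (T : choiceType)
    (j : {additive A -> {freeg T / int}}) :
  injective j -> free_abelian A.
Proof.
move=> j_inj; have [R R_wo] := well_ordering_principle T.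
exact: (sub_free_of_well_order j_inj R_wo).
Qed.

(** * Transition maps, the subgroups [Im], and pointwise surjections *)

Section Functors.
Variables (d : Order.disp_t) (P : porderType d).
Implicit Types F G H : functorAb P.

Lemma fmap_irr F (p q : P) (pq pq' : (p <= q)%O) : fmap F pq =1 fmap F pq'.
Proof. by move=> x; rewrite (bool_irrelevance pq pq'). Qed.

Lemma fmapK F (p : P) (pp : (p <= p)%O) (x : F p) : fmap F pp x = x.
Proof. by rewrite (fmap_irr pp (lexx p)) fmap_id. Qed.

Lemma fmapD F (p q r : P) (pq : (p <= q)%O) (qr : (q <= r)%O) (pr : (p <= r)%O)
  (x : F p) : fmap F qr (fmap F pq x) = fmap F pr x.
Proof. by rewrite -fmap_comp (fmap_irr _ pr). Qed.

Lemma ImP F (p : P) (x : F p) : reflect (Im x) (x \in @Im_pred d P F p).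
Proof. exact: asboolP. Qed.

Lemma Coker_pi_eq0 F (p : P) (x : F p) :
  (\pi_(Coker F p)%qT x == 0) = (x \in @Im_pred d P F p).
Proof. by rewrite -[x in RHS]subr0 Quotient.idealrBE raddf0. Qed.

Lemma Im_fmap F (p q : P) (pq : (p <= q)%O) (x : F p) :
  p != q -> fmap F pq x \in @Im_pred d P F q.
Proof.
move=> npq; have ltpq : (p < q)%O by rewrite lt_neqAle npq.
pose I := {i : P | (i < q)%O}.
apply/ImP; exists [:: existT (fun i : I => F (val i)) (exist _ p ltpq : I) x].
by rewrite big_seq1; apply: fmap_irr.
Qed.

Lemma Im_nattrans F G (a : nattrans F G) (p : P) (x : F p) :
  x \in @Im_pred d P F p -> a p x \in @Im_pred d P G p.
Proof.
case/ImP=> s ->; rewrite raddf_sum rpred_sum // => t _.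
by rewrite /= naturality Im_fmap // lt_eqF // (valP (tag t)).
Qed.

Lemma surj_epimorphism G H (e : nattrans G H) :
  (forall p y, exists x, e p x = y) -> epimorphism e.
Proof. by move=> e_surj K a b ab p y; have [x <-] := e_surj p y; apply: ab. Qed.

Definition nt_id F : nattrans F F :=
  @Nattrans d P F F (fun p => idfun) (fun _ _ _ _ => erefl).

End Functors.

(** * Pointwise cokernels and epimorphisms of functors *)

Section QuotientLift.
Variables (A : zmodType) (S : zmodClosed A) (B : zmodType).
Variable f : {additive A -> B}.
Hypothesis fS : {in S, forall x, f x = 0}.

Definition quot_lift of {in S, forall x, f x = 0} :=
  fun c : {ideal_quot S} => f (repr c).

Lemma quot_liftE x : quot_lift fS (\pi_({ideal_quot S})%qT x) = f x.
Proof.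
apply/eqP; rewrite -subr_eq0 -raddfB fS //.
by rewrite Quotient.idealrBE reprK.
Qed.

Lemma quot_lift_is_zmod_morphism : zmod_morphism (quot_lift fS).
Proof.
move=> x y; rewrite -[x]reprK -[y]reprK -raddfB !quot_liftE.
exact: raddfB.
Qed.

HB.instance Definition _ :=
  GRing.isZmodMorphism.Build {ideal_quot S} B (quot_lift fS)
    quot_lift_is_zmod_morphism.

End QuotientLift.

(* The cokernel of an epimorphism of functors vanishes, hence epimorphisms are
   pointwise surjective. *)
Section Cokernel.
Variables (d : Order.disp_t) (P : porderType d) (G H : functorAb P).
Variable e : nattrans G H.

Definition img_pred (p : P) : {pred H p} := fun y => `[< exists x, e p x = y >].

Lemma img_zmod_closed p : zmod_closed (@img_pred p).
Proof.
split=> [|_ _ /asboolP[x <-] /asboolP[y <-]]; apply/asboolP.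
  by exists 0; rewrite raddf0.
by exists (x - y); rewrite raddfB.
Qed.

HB.instance Definition _ (p : P) :=
  GRing.isZmodClosed.Build (H p) (@img_pred p) (@img_zmod_closed p).

Definition coker_obj (p : P) : zmodType := {ideal_quot @img_pred p}.

Definition coker_pi (p : P) : {additive H p -> coker_obj p} :=
  \pi_({ideal_quot @img_pred p})%qT.

Lemma coker_pi_surj p (c : coker_obj p) : exists y, c = coker_pi p y.
Proof. by exists (repr c); apply/esym/reprK. Qed.

Lemma coker_pi_eq0 p y : (coker_pi p y == 0) = (y \in @img_pred p).
Proof. by rewrite -[y in RHS]subr0 Quotient.idealrBE raddf0. Qed.

Lemma coker_fmap_subproof (p q : P) (pq : (p <= q)%O) :
  {in @img_pred p, forall y, (coker_pi q \o fmap H pq) y = 0}.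
Proof.
move=> _ /asboolP[x <-]; apply/eqP; rewrite /= coker_pi_eq0 -naturality.
by apply/asboolP; exists (fmap G pq x).
Qed.

Definition coker_fmap (p q : P) (pq : (p <= q)%O) :
  {additive coker_obj p -> coker_obj q} := quot_lift (coker_fmap_subproof pq).

Lemma coker_fmapE (p q : P) (pq : (p <= q)%O) y :
  coker_fmap pq (coker_pi p y) = coker_pi q (fmap H pq y).
Proof. exact: quot_liftE. Qed.

Lemma coker_fmap_id (p : P) x : coker_fmap (lexx p) x = x.
Proof. by have [y ->] := coker_pi_surj x; rewrite coker_fmapE fmap_id. Qed.

Lemma coker_fmap_comp (p q r : P) (pq : (p <= q)%O) (qr : (q <= r)%O) x :
  coker_fmap (le_trans pq qr) x = coker_fmap qr (coker_fmap pq x).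
Proof. by have [y ->] := coker_pi_surj x; rewrite !coker_fmapE fmap_comp. Qed.

Definition coker : functorAb P :=
  @FunctorAb d P coker_obj coker_fmap coker_fmap_id coker_fmap_comp.

Definition coker_nt : nattrans H coker :=
  @Nattrans d P H coker coker_pi (fun p q pq x => esym (coker_fmapE pq x)).

Definition zero_nt : nattrans H coker :=
  @Nattrans d P H coker (fun p => \0) (fun p q pq x => esym (raddf0 _)).

Lemma epimorphism_surj : epimorphism e -> forall p y, exists x, e p x = y.
Proof.
move=> e_epi p y; apply/asboolP; rewrite -[asbool _]coker_pi_eq0.
apply/eqP/(e_epi coker coker_nt zero_nt) => q x; apply/eqP.
by rewrite /= coker_pi_eq0; apply/asboolP; exists x.
Qed.

End Cokernel.

(** * Free functors and their components *)

Section FreeFunctor.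
Variables (d : Order.disp_t) (P : porderType d) (T : P -> choiceType).

Definition gens (p : P) : choiceType := {k : {i : P & T i} | (tag k <= p)%O}.

Definition widen_gen (p q : P) (pq : (p <= q)%O) (k : gens p) : gens q :=
  exist _ (val k) (le_trans (valP k) pq).

Definition gen (p : P) (t : T p) : gens p := exist _ (Tagged T t) (lexx p).

Definition free_obj (p : P) : zmodType := {freeg (gens p) / int}.

Definition free_fmap (p q : P) (pq : (p <= q)%O) :
    {additive free_obj p -> free_obj q} :=
  zlift (fun k => << widen_gen pq k >>).

Lemma free_fmapU (p q : P) (pq : (p <= q)%O) k :
  free_fmap pq << k >> = << widen_gen pq k >>.
Proof. exact: zliftU. Qed.

Lemma free_fmap_id (p : P) x : free_fmap (lexx p) x = x.
Proof.
apply: (freeg_ext (h := idfun)) => k; rewrite free_fmapU /=.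
by congr << _ >>; apply: val_inj.
Qed.

Lemma free_fmap_comp (p q r : P) (pq : (p <= q)%O) (qr : (q <= r)%O) x :
  free_fmap (le_trans pq qr) x = free_fmap qr (free_fmap pq x).
Proof.
apply: (freeg_ext (h := free_fmap qr \o free_fmap pq)) => k /=.
by rewrite !free_fmapU; congr << _ >>; apply: val_inj.
Qed.

Definition free_functor : functorAb P :=
  @FunctorAb d P free_obj free_fmap free_fmap_id free_fmap_comp.

Lemma gensE (p : P) (k : gens p) :
  << k >> = fmap free_functor (valP k) << gen (tagged (val k)) >>.
Proof.
rewrite [RHS]free_fmapU; congr << _ >>; apply: val_inj => /=.
by case: (val k).
Qed.

Lemma genP (p : P) (k : gens p) : tag (val k) = p -> exists t, k = gen t.
Proof.
case: k => -[i t] /= ip ei; case: _ / ei ip => ip.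
by exists t; apply: val_inj.
Qed.

Section Universal.
Variables (G : functorAb P) (v : forall i : P, T i -> G i).

Definition free_lift_fun (p : P) : {additive free_functor p -> G p} :=
  zlift (fun k : gens p => fmap G (valP k) (v (tagged (val k)))).

Lemma free_lift_natural (p q : P) (pq : (p <= q)%O) x :
  free_lift_fun q (fmap free_functor pq x) = fmap G pq (free_lift_fun p x).
Proof.
apply: (freeg_ext (g := free_lift_fun q \o fmap free_functor pq)
  (h := fmap G pq \o free_lift_fun p)) => k /=.
by rewrite !zliftU; apply/esym/fmapD.
Qed.

Definition free_lift : nattrans free_functor G :=
  @Nattrans d P free_functor G free_lift_fun free_lift_natural.

Lemma free_liftE (p : P) (t : T p) : free_lift p << gen t >> = v t.
Proof. by rewrite /= /free_lift_fun zliftU fmapK. Qed.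

End Universal.

Lemma free_nt_ext (G : functorAb P) (a b : nattrans free_functor G) :
  (forall p (t : T p), a p << gen t >> = b p << gen t >>) -> nt_eq a b.
Proof. by move=> ab p; apply: freeg_ext => k; rewrite gensE !naturality ab. Qed.

(** For [i <= p], the projection onto the summand spanned by the pairs over [i]; pairs over other
    objects go to the default value 0. *)
Definition free_at (i p : P) :
    {additive free_functor p -> {freeg (T i) / int}} :=
  zlift (fun k : gens p => untag 0 (fun t : T i => << t >>) (val k)).

Definition free_inc (p : P) :
    {additive {freeg (T p) / int} -> free_functor p} :=
  zlift (fun t => << gen t >>).

Lemma free_at_fmap (i p q : P) (pq : (p <= q)%O) u :
  free_at i q (fmap free_functor pq u) = free_at i p u.
Proof.
apply: (freeg_ext (g := free_at i q \o fmap free_functor pq)) => k /=.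
by rewrite !zliftU.
Qed.

Lemma free_at_nle (i p : P) u : ~~ (i <= p)%O -> free_at i p u = 0.
Proof.
move=> nip; apply: (freeg_ext (h := \0)) => k; rewrite [LHS]zliftU.
by apply: untag_dflt; apply: contraNneq nip => <-; apply: (valP k).
Qed.

Lemma free_at_gen (p : P) (t : T p) : free_at p p << gen t >> = << t >>.
Proof.
by rewrite [LHS]zliftU (untagE _ _ (erefl p : tag (val (gen t)) = p)).
Qed.

Lemma free_at_inc (p : P) w : free_at p p (free_inc p w) = w.
Proof.
apply: (freeg_ext (g := free_at p p \o free_inc p) (h := idfun)) => t /=.
by rewrite /free_inc zliftU free_at_gen.
Qed.

(** The components at all objects together determine [u]. *)
Lemma coeff_free_at (p : P) (k : gens p) u :
  coeff (tagged (val k)) (free_at (tag (val k)) p u) = coeff k u.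
Proof.
apply: (freeg_ext (A := int)
  (g := coeff (tagged (val k)) \o free_at (tag (val k)) p)
  (h := coeff k)) => l /=.
rewrite zliftU coeffU mul1r.
case: k l => -[i t] /= ip [[j s] /= jp].
have [eij|nij] := eqVneq j i; last first.
  rewrite untag_dflt // coeff0 -val_eqE /= -tag_eqE /tag_eq /=.
  by rewrite (negPf nij).
case: _ / eij t ip => t ip.
rewrite (untagE _ _ (erefl j : tag (Tagged T s) = j)).
by rewrite coeffU mul1r -val_eqE /= eq_Tagged.
Qed.

(** On a pair over [i <> p] the difference is the pair itself, an image from [i]; on a pair over [p]
    it is 0. *)
Lemma Im_free_dec (p : P) u :
  u - free_inc p (free_at p p u) \in @Im_pred d P free_functor p.
Proof.
apply: (freeg_in_closed (S := @Im_pred d P free_functor p)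
  (h := idfun \- (free_inc p \o free_at p p))) => k /=.
have [kp|nkp] := eqVneq (tag (val k)) p; last first.
  rewrite zliftU untag_dflt // raddf0 subr0 gensE.
  exact: Im_fmap.
by have [t ->] := genP kp; rewrite free_at_gen zliftU subrr; apply: rpred0.
Qed.

(** Elements coming from below [p] have no component at [p]; the converse is [Im_free_dec]. *)
Lemma free_at_eq0P (p : P) (u : free_functor p) : free_at p p u = 0 <-> Im u.
Proof.
split=> [u0|[s ->]].
  by apply/ImP; have := Im_free_dec u; rewrite u0 raddf0 subr0.
rewrite raddf_sum big1 // => t _; rewrite free_at_fmap free_at_nle //.
by rewrite lt_geF // (valP (tag t)).
Qed.

End FreeFunctor.

Arguments free_at {d P T} i p.
Arguments free_inc {d P T} p.

(** * Projective functors have free cokernels and are pseudo-projective *)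

Section ProjectiveIsPseudoProjective.
Variables (d : Order.disp_t) (P : porderType d) (F : functorAb P).
Hypothesis F_proj : projective F.

Let T (p : P) : choiceType := F p.
Let Q := free_functor T.
Let pi : nattrans Q F := free_lift (fun (p : P) (x : T p) => x).

Lemma projective_split : exists s : nattrans F Q, forall p x, pi p (s p x) = x.
Proof.
have pi_epi : epimorphism pi.
  apply: surj_epimorphism => p y; exists << gen (y : T p) >>.
  exact: free_liftE.
by have [s sE] := F_proj (nt_id F) pi_epi; exists s.
Qed.

(** Turns membership in [Im] into the vanishing of a homomorphism to a free group; both [s] and its
    retraction [pi] preserve [Im]. *)
Lemma projective_free_at : exists s : nattrans F Q,
  forall p x, free_at p p (s p x) = 0 <-> Im x.
Proof.
have [s sK] := projective_split; exists s => p x; rewrite free_at_eq0P.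
split=> /ImP h; apply/ImP; last exact: Im_nattrans.
by rewrite -(sK p x); apply: Im_nattrans.
Qed.

Lemma projective_Coker_free p : free_abelian (Coker F p).
Proof.
have [s s0] := projective_free_at.
have kill : {in @Im_pred d P F p, forall x, (free_at p p \o s p) x = 0}.
  by move=> x /ImP/s0.
apply: (@sub_free_abelian _ (T p) (quot_lift kill)).
apply: raddf_inj => c; rewrite -[c]reprK.
move=> /(etrans (esym (quot_liftE kill _)))/s0/ImP.
by rewrite -Coker_pi_eq0 => /eqP.
Qed.

Lemma projective_pseudo_projective (deg : P -> int) :
  (forall p q : P, (p < q)%O -> deg p < deg q) -> pseudo_projective deg F.
Proof.
move=> deg_lt n i0 k i i_inj alpha alpha_n x x0 j.
have [s s0] := projective_free_at; apply/s0.
have deg_i l : deg (i l) = deg i0 - n%:Z.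
  have le_deg : deg (i l) <= deg i0.
    by have := alpha l; rewrite le_eqVlt => /predU1P[->|/deg_lt/ltW].
  by rewrite -(alpha_n l) /arrow_degree gez0_abs ?subr_ge0 // subKr.
(* Distinct objects of equal degree are incomparable, so only the summand [j] has a component at
   [i j]. *)
have := congr1 (fun y => free_at (i j) i0 (s i0 y)) x0; rewrite /= !raddf0.
rewrite !raddf_sum (bigD1 j) //= naturality free_at_fmap.
rewrite big1 ?addr0 // => l nlj.
rewrite naturality free_at_fmap free_at_nle // le_eqVlt negb_or.
rewrite (inj_eq i_inj) eq_sym nlj /=.
by apply/negP => /deg_lt; rewrite !deg_i ltxx.
Qed.

End ProjectiveIsPseudoProjective.

(** * Pseudo-projective functors with free cokernels are projective *)

Section PseudoProjectiveIsProjective.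
Variables (d : Order.disp_t) (P : porderType d) (deg : P -> int).
Hypothesis degP : degree_function deg.

Lemma degree_le (p q : P) : (p <= q)%O -> deg p <= deg q.
Proof. by rewrite le_eqVlt => /predU1P[->|/degP.1/ltW]. Qed.

(** Induction on the degree of the arrow: if [p] precedes [q], no degree lies strictly between;
    otherwise an intermediate [r] splits the interval into two shorter ones. *)
Lemma degree_between (p q : P) (D : int) : (p <= q)%O -> deg p <= D <= deg q ->
  exists r : P, [/\ (p <= r)%O, (r <= q)%O & deg r = D].
Proof.
have [n] := ubnP `|deg q - deg p|%N; elim: n p q => // n IHn p q ltn pq.
move=> /andP[pD Dq].
have [eD|npD] := eqVneq D (deg p); first by exists p.
have [eD|nqD] := eqVneq D (deg q); first by exists q.
have ltpD : deg p < D by rewrite lt_neqAle eq_sym npD.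
have ltDq : D < deg q by rewrite lt_neqAle nqD.
have ltpq : (p < q)%O.
  rewrite lt_neqAle pq andbT; apply: contraTneq ltpD => ->.
  by rewrite -leNgt ltW.
have [prec|nprec] := pselect (precedes p q).
  by move: ltDq; rewrite (degP.2 _ _ prec) ltzD1 leNgt ltpD.
have [r [ltpr ltrq]] : exists r, (p < r)%O /\ (r < q)%O.
  apply: contrapT => nr; apply: nprec; split=> // r pr rq.
  have [->|npr] := eqVneq r p; first by left.
  have [->|nrq] := eqVneq r q; first by right.
  by case: nr; exists r; rewrite !lt_neqAle eq_sym npr pr nrq.
have [degpr degrq] := (degP.1 _ _ ltpr, degP.1 _ _ ltrq).
have [Dr|rD] := leP D (deg r).
  have [||t [pt tr tD]] := IHn p r _ (ltW ltpr); rewrite ?pD //.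
    rewrite -ltnS (leq_trans _ ltn) // ltnS -ltz_nat.
    by rewrite !gez0_abs ?subr_ge0 ?ltrD2 // ltW // (lt_trans degpr).
  by exists t; rewrite pt tD (le_trans tr (ltW ltrq)).
have [||t [rt tq tD]] := IHn r q _ (ltW ltrq); rewrite ?Dq ?ltW //.
  rewrite -ltnS (leq_trans _ ltn) // ltnS -ltz_nat.
  by rewrite !gez0_abs ?subr_ge0 ?ltrD2l ?ltrN2 // ltW // (lt_trans degpr).
by exists t; rewrite (le_trans (ltW ltpr) rt).
Qed.

(** Each key of [u] factors through a chosen object of degree [D]; grouping keys by that object
    makes the [i j] distinct. *)
Lemma free_gather (T : P -> choiceType) (p : P) (D : int)
    (u : free_functor T p) :
  {in dom u, forall k, deg (tag (val k)) <= D} -> D <= deg p ->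
  exists (n : nat) (i : 'I_n -> P) (alpha : forall j, (i j <= p)%O)
      (v : forall j, free_functor T (i j)),
    [/\ injective i, forall j, deg (i j) = D &
      u = \sum_(j < n) fmap (free_functor T) (alpha j) (v j)].
Proof.
move=> uD Dp; pose I := {i : P | (i <= p)%O}.
have mid (k : gens T p) : exists r : I, k \in dom u ->
    (tag (val k) <= val r)%O /\ deg (val r) = D.
  (* Outside the support of [u] any object serves as a dummy. *)
  have [ku|_] := boolP (k \in dom u); last by exists (exist _ p (lexx p) : I).
  have [|r [kr rp rD]] := degree_between (valP k) (D := D); first by rewrite uD.
  by exists (exist _ r rp : I).
pose c k := sval (cid (mid k)); have cP k := svalP (cid (mid k)) : _ -> _.
pose s := undup (map c (dom u)).
(* The term of [u] at [k], moved back to [r]. The default 0 never occurs for [r = c k] with [k] in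
   the support. *)
pose term (r : I) (k : gens T p) : free_functor T (val r) :=
  if (tag (val k) <= val r)%O =P true is ReflectT h
  then << exist _ (val k) h : gens T (val r) >> *~ coeff k u else 0.
exists (size s), (fun j => val (tnth (in_tuple s) j)),
  (fun j => valP (tnth (in_tuple s) j)),
  (fun j => \sum_(k <- dom u | c k == tnth (in_tuple s) j)
     term (tnth (in_tuple s) j) k); split.
- by move=> j l /val_inj/tuple_uniqP; apply; rewrite /= undup_uniq.
- move=> j; have := mem_tnth j (in_tuple s).
  rewrite mem_undup => /mapP[k ku ->].
  by case: (cP k ku).
rewrite -(big_tnth _ _ s xpredT (fun r => fmap (free_functor T) (valP r)
  (\sum_(k <- dom u | c k == r) term r k))).
under eq_bigr do rewrite raddf_sum.
rewrite (exchange_big_dep xpredT) //= [LHS]freeg_sumzE.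
rewrite big_seq [RHS]big_seq; apply: eq_bigr => k ku.
have cs : c k \in s by rewrite mem_undup map_f.
rewrite (eq_bigl (pred1 (c k))) => [|r]; last exact: eq_sym.
rewrite -big_filter filter_pred1_uniq ?undup_uniq // big_seq1 /term.
case: eqP => [h|]; last by case: (cP k ku).
rewrite [RHS]raddfMz [X in _ = X *~ _]zliftU.
by congr (<< _ >> *~ _); apply: val_inj.
Qed.

(** The lower bound [m] makes [deg p - m] a natural number to induct on. *)
Lemma degree_lt_ind (K : P -> Prop) :
  (exists m : int, forall p, m <= deg p) ->
  (forall p, (forall q, (q < p)%O -> K q) -> K p) -> forall p, K p.
Proof.
move=> [m m_le] Kind p.
have [n] := ubnP `|deg p - m|%N; elim: n p => // n IHn p ltn.
apply: Kind => q /degP.1 ltqp; apply: IHn.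
rewrite -ltnS (leq_trans _ ltn) // ltnS -ltz_nat.
by rewrite !gez0_abs ?subr_ge0 ?ltrD2r.
Qed.

Section CokerBasis.
Variables (F : functorAb P) (B : P -> choiceType).
Variable f : forall p, {additive {freeg (B p) / int} -> Coker F p}.

Let Q := free_functor B.
Let basis (p : P) (t : B p) : F p := repr (f p << t >>).
Let Phi : nattrans Q F := free_lift basis.

(** Pairs over [i <> p] are sent into the image subgroup, so only the component at [p] survives in
    the cokernel. *)
Lemma basis_lift_Coker p u : \pi_(Coker F p)%qT (Phi p u) = f p (free_at p p u).
Proof.
apply: (freeg_ext (g := \pi_(Coker F p)%qT \o Phi p)
  (h := f p \o free_at p p)) => k.
have [kp|nkp] := eqVneq (tag (val k)) p.
  have [t ->] := genP kp.
  by rewrite [RHS]/= free_at_gen [LHS]/= zliftU fmapK reprK.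
rewrite [RHS]/= [in RHS]zliftU untag_dflt // raddf0; apply/eqP.
by rewrite /= Coker_pi_eq0 zliftU Im_fmap.
Qed.

(** Lifting the class of [y] leaves an error in the image subgroup, a sum of elements from lower
    objects that are reached by induction. *)
Lemma basis_lift_surj : (forall p c, exists w, f p w = c) ->
  (exists m : int, forall p, m <= deg p) ->
  forall p y, exists u, Phi p u = y.
Proof.
move=> f_surj bounded; apply: (degree_lt_ind bounded) => p IHp y.
have [w wy] := f_surj p (\pi_(Coker F p)%qT y).
have : y - Phi p (free_inc p w) \in @Im_pred d P F p.
  by rewrite Quotient.idealrBE basis_lift_Coker free_at_inc wy.
case/ImP => s sE.
pose pre (t : {i : {i : P | (i < p)%O} & F (val i)}) :=
  sval (cid (IHp _ (valP (tag t)) (tagged t))).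
exists (free_inc p w + \sum_(t <- s) fmap Q (ltW (valP (tag t))) (pre t)).
rewrite raddfD raddf_sum -(subrK (Phi p (free_inc p w)) y) sE addrC.
congr (_ + _); apply: eq_bigr => t _; rewrite naturality.
by congr (fmap F _ _); apply: (svalP (cid (IHp _ (valP (tag t)) (tagged t)))).
Qed.

Lemma basis_lift_inj : (forall p, injective (f p)) -> pseudo_projective deg F ->
  forall p, injective (Phi p).
Proof.
move=> f_inj F_pp p; apply: raddf_inj => u u0; apply/eqP; rewrite -dom_eq0.
apply: contraT => nz.
have nz' : [seq deg (tag (val k)) | k <- dom u] != [::] by case: (dom u) nz.
have [_ /mapP[k ku ->] kmax] :=
  seq_max (@lexx _ int) (@le_trans _ int) (@le_total _ int) nz'.
have u_le : {in dom u, forall l, deg (tag (val l)) <= deg (tag (val k))}.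
  by move=> l lu; apply/kmax/map_f.
have [n [i [alpha [v [i_inj i_deg uE]]]]] :=
  free_gather u_le (degree_le (valP k)).
(* Pseudo-projectivity makes the class of [Phi (v j)] zero in the cokernel, and [f] is injective. *)
have v0 j : free_at (i j) (i j) (v j) = 0.
  apply: (f_inj (i j)); rewrite raddf0 -basis_lift_Coker; apply/eqP.
  rewrite Coker_pi_eq0; apply/ImP.
  have alphaE l : arrow_degree deg (alpha l) = `|deg p - deg (tag (val k))|%N.
    by rewrite /arrow_degree i_deg.
  apply: (F_pp _ p _ _ i_inj alpha alphaE (fun l => Phi (i l) (v l))).
  rewrite -[RHS]u0 [in RHS]uE raddf_sum; apply: eq_bigr => l _.
  by rewrite naturality.
(* The coefficient of [u] at [k] is read off the [v j]: [v0] kills it if [i j] is the object of [k];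
   otherwise the two objects are incomparable, having equal degree. *)
move: ku; rewrite mem_dom -coeff_free_at uE raddf_sum big1 ?coeff0 ?eqxx //.
move=> j _.
rewrite free_at_fmap.
have [ij|nij] := eqVneq (tag (val k)) (i j); first by rewrite ij v0.
apply: free_at_nle; rewrite le_eqVlt (negPf nij) /=.
by apply/negP => /degP.1; rewrite i_deg ltxx.
Qed.

End CokerBasis.

(** A free functor lifts through pointwise surjections by choosing preimages of the generators; the
    inverse of [a] carries the lift to [F]. *)
Lemma free_iso_projective (F : functorAb P) (B : P -> choiceType)
    (a : nattrans (free_functor B) F) :
  (forall p, injective (a p)) -> (forall p y, exists u, a p u = y) ->
  projective F.
Proof.
move=> a_inj a_surj G H e h /epimorphism_surj e_surj.
pose lift p (t : B p) := cid (e_surj p (h p (a p << gen t >>))).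
pose g := free_lift (fun p t => sval (lift p t)).
have gE : nt_eq (nt_comp e g) (nt_comp h a).
  apply: free_nt_ext => p t; rewrite [LHS]/= zliftU fmapK.
  exact: (svalP (lift p t)).
pose inv p y := sval (cid (a_surj p y)).
have invK p y : a p (inv p y) = y by apply: svalP (cid (a_surj p y)).
have inv_additive p : zmod_morphism (inv p).
  by move=> x y; apply: (a_inj p); rewrite raddfB !invK.
pose inv' p : {additive F p -> free_functor B p} :=
  HB.pack (inv p) (GRing.isZmodMorphism.Build _ _ (inv p) (inv_additive p)).
have inv_natural p q (pq : (p <= q)%O) x :
    inv' q (fmap F pq x) = fmap _ pq (inv' p x).
  by apply: (a_inj q); rewrite naturality /= !invK.
exists (nt_comp g (Nattrans inv_natural)) => p y.
by rewrite -[in RHS](invK p y); apply: gE.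
Qed.

End PseudoProjectiveIsProjective.

Theorem theoremA (d : Order.disp_t) (P : porderType d)
    (bounded : bounded_below_graded P)
    (deg : P -> int) (degP : degree_function deg)
    (F : functorAb P) :
  projective F <->
  ((forall i0 : P, free_abelian (Coker F i0)) /\ pseudo_projective deg F).
Proof.
split=> [F_proj|[F_free F_pp]].
  split; first exact: projective_Coker_free.
  by apply: projective_pseudo_projective => //; case: degP.
pose B p := sval (cid (F_free p)).
pose f p : {additive {freeg (B p) / int} -> Coker F p} :=
  sval (cid (svalP (cid (F_free p)))).
have f_bij p : bijective (f p) by apply: svalP (cid (svalP (cid (F_free p)))).
case: bounded => deg' degP' bounded.
apply: (free_iso_projective (basis_lift_inj degP (f := f) _ F_pp)).
  by move=> p; apply: bij_inj.
(* The bounded below degree function may differ from deg. *)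
apply: (basis_lift_surj degP') => // p c.
by have [g _ gK] := f_bij p; exists (g c).
Qed.
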